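(* Let $f:X\to Y$ be a continuous map between zero-dimensional locally compact Hausdorff spaces, let $(A,I)=(CO(X),CK(X))$, $(B,J)=(CO(Y),CK(Y))$, and let $\varphi=\Theta^t(f):B\to A$ be given by $\varphi(G)=f^{-1}(G)$. For $b\in B$ put $I_{\varphi(b)}=\{a\in I : a\le\varphi(b)\}$. Then the following conditions are equivalent: (a) $f$ is a surjection; (b) $\varphi$ is an injection and for every bounded ultrafilter $v$ in $(B,J)$ there exists $a\in I$ such that $a\wedge\varphi(b)\neq 0$ for every $b\in v$; (c) $\varphi$ is an injection and for every prime ideal $J_1$ of $J$: if $\bigvee\{I_{\varphi(b)} : b\in J_1\}=I$ then $J_1=J$; (d) $\varphi$ is an injection and for every ideal $J_1$ of $J$: if $\bigvee\{I_{\varphi(b)} : b\in J_1\}=I$ then $J_1=J$.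
   Context: A space is zero-dimensional if its clopen subsets form a base. $CO(X)$ is the Boolean algebra of clopen subsets of $X$ and $CK(X)$ is the set of compact clopen subsets of $X$ (an ideal of $CO(X)$). A bounded ultrafilter in $(B,J)$ is an ultrafilter $v$ of the Boolean algebra $B$ with $v\cap J\neq\emptyset$. Ideals and prime ideals are allowed to be non-proper; an ideal $J_1$ of $J$ is prime if $a\wedge b\in J_1$ (with $a,b\in J$) implies $a\in J_1$ or $b\in J_1$. The joins $\bigvee\{I_{\varphi(b)} : b\in J_1\}$ are taken in the frame $Idl(I)$ of all ideals of $I$. *)

(* Defs.v *)
From HB Require Import structures.
From mathcomp Require Import all_boot all_order.
From mathcomp Require Import all_classical topology.

Set Implicit Arguments.
Unset Strict Implicit.
Unset Printing Implicit Defensive.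

Import Order.TTheory.

Local Open Scope classical_set_scope.

(* The clopen sets form a base of the topology.  The library predicate
   [zero_dimensional] only asks that clopen sets separate points. *)
Definition clopen_base (T : topologicalType) : Prop := basis (@clopen T).

Section BooleanAlgebra.
Context {d : Order.disp_t} {B : ctbDistrLatticeType d}.
Local Open Scope order_scope.

(* An ideal of [J], where [J] is regarded as a lattice with the order of [B];
   [J = setT] gives the ideals of [B], and [K = J] is not excluded. *)
Record ideal_of (J K : set B) : Prop := IdealOf {
  ideal_sub : (K `<=` J)%classic;
  ideal_bot : K \bot;
  ideal_join : forall a b, K a -> K b -> K (a `|` b);
  ideal_down : forall a b, J a -> K b -> a <= b -> K a
}.

Definition prime_ideal_of (J K : set B) : Prop :=
  ideal_of J K /\ forall a b, J a -> J b -> K (a `&` b) -> K a \/ K b.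

(* The join of the family [F b], [b \in D], in the frame Idl(I) of the ideals
   of [I] ordered by inclusion; see [idl_join_lub]. *)
Definition idl_join (I : set B) (T : Type) (D : set T) (F : T -> set B) :
  set B := smallest (ideal_of I) (\bigcup_(b in D) F b)%classic.

Definition ideal_below (I : set B) (c : B) : set B := [set a | I a /\ a <= c].

Record lat_proper_filter (v : set B) : Prop := LatProperFilter {
  lat_filter_top : v \top;
  lat_filter_meet : forall a b, v a -> v b -> v (a `&` b);
  lat_filter_up : forall a b, v a -> a <= b -> v b;
  lat_filter_proper : ~ v \bot
}.

Definition lat_ultrafilter (v : set B) : Prop :=
  lat_proper_filter v /\
  forall w, lat_proper_filter w -> (v `<=` w)%classic -> w = v.

Definition bounded_ultrafilter (J v : set B) : Prop :=
  lat_ultrafilter v /\ (v `&` J !=set0)%classic.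

Lemma ideal_below_ideal (I : set B) (c : B) :
  ideal_of setT I -> ideal_of I (ideal_below I c).
Proof.
move=> [_ I0 IU ID]; split.
- by move=> a [].
- by split; rewrite ?le0x.
- by move=> a b [Ia ac] [Ib bc]; split; [exact: IU|rewrite leUx ac bc].
- by move=> a b Ia [_ bc] ab; split => //; exact: le_trans bc.
Qed.

Lemma idl_join_lub (I : set B) (T : Type) (D : set T) (F : T -> set B) :
  ideal_of setT I -> (forall b, D b -> ideal_of I (F b)) ->
  [/\ ideal_of I (idl_join I D F),
      forall b, D b -> (F b `<=` idl_join I D F)%classic &
      forall K, ideal_of I K -> (forall b, D b -> F b `<=` K)%classic ->
        (idl_join I D F `<=` K)%classic].
Proof.
move=> [_ I0 IU ID] FI.
have II : ideal_of I I by split => // a b Ia Ib; exact: IU.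
split.
- split.
  + by apply: smallest_sub => // a [b Db]; exact: (ideal_sub (FI b Db)).
  + by move=> K [KI _]; exact: ideal_bot KI.
  + move=> a b Ka Kb K KP; have [KI _] := KP.
    by apply: (ideal_join KI); [exact: Ka|exact: Kb].
  + move=> a b Ia Kb ab K KP; have [KI _] := KP.
    by apply: (ideal_down KI Ia _ ab); exact: Kb.
- by move=> b Db a Fa; apply: sub_gen_smallest; exists b.
- by move=> K KI FK; apply: smallest_sub => // a [b Db]; exact: FK.
Qed.

End BooleanAlgebra.

(* The Boolean algebra of clopen subsets, ordered by inclusion. *)
Definition CO (T : topologicalType) : Type := set_type (@clopen T).

Fact CO_display : Order.disp_t. Proof. exact: (Order.Disp tt tt). Qed.

Section CO.
Context {T : topologicalType}.
Implicit Types U V W : CO T.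

HB.instance Definition _ := Choice.on (CO T).

Definition COset U : set T := set_val U.

Lemma COsetP U : clopen (COset U).
Proof. exact: set_mem (valP U). Qed.

Lemma COset_inj : injective COset.
Proof. exact: val_inj. Qed.

Definition mkCO (A : set T) (cA : clopen A) : CO T := SigSub (mem_set cA).

Definition CO_le U V : bool := `[< COset U `<=` COset V >].

Fact CO_le_refl : reflexive CO_le.
Proof. by move=> U; apply/asboolP. Qed.

Fact CO_le_anti : antisymmetric CO_le.
Proof.
by move=> U V /andP[/asboolP UV /asboolP VU]; apply/COset_inj/seteqP; split.
Qed.

Fact CO_le_trans : transitive CO_le.
Proof.
by move=> V U W /asboolP UV /asboolP VW; apply/asboolP/(subset_trans UV).
Qed.

HB.instance Definition _ := Order.Le_isPOrder.Build CO_display (CO T)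
  CO_le_refl CO_le_anti CO_le_trans.

Definition CO_meet U V : CO T := mkCO (clopenI (COsetP U) (COsetP V)).
Definition CO_join U V : CO T := mkCO (clopenU (COsetP U) (COsetP V)).
Definition CO_bot : CO T := mkCO clopen0.
Definition CO_top : CO T := mkCO clopenT.
Definition CO_compl U : CO T := mkCO (clopenC (COset U) (COsetP U)).

Fact CO_meetP U V W : (U <= CO_meet V W)%O = ((U <= V)%O && (U <= W)%O).
Proof.
apply/asboolP/andP => [UVW|[/asboolP UV /asboolP UW]]; last first.
  by move=> x Ux; split; [exact: UV|exact: UW].
by split; apply/asboolP => x /UVW[].
Qed.

Fact CO_joinP U V W : (CO_join U V <= W)%O = ((U <= W)%O && (V <= W)%O).
Proof.
apply/asboolP/andP => [UVW|[/asboolP UW /asboolP VW]]; last first.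
  by move=> x [/UW|/VW].
by split; apply/asboolP => x ?; apply: UVW; [left|right].
Qed.

HB.instance Definition _ := Order.POrder_MeetJoin_isLattice.Build
  CO_display (CO T) CO_meetP CO_joinP.

Fact CO_meetUl : left_distributive CO_meet CO_join.
Proof. by move=> U V W; apply: COset_inj; exact: setIUl. Qed.

HB.instance Definition _ := Order.Lattice_Meet_isDistrLattice.Build
  CO_display (CO T) CO_meetUl.

Fact CO_le0x U : (CO_bot <= U)%O.
Proof. by apply/asboolP; exact: sub0set. Qed.

HB.instance Definition _ := Order.hasBottom.Build CO_display (CO T) CO_le0x.

Fact CO_lex1 U : (U <= CO_top)%O.
Proof. by apply/asboolP; exact: subsetT. Qed.

HB.instance Definition _ := Order.hasTop.Build CO_display (CO T) CO_lex1.

Fact CO_joinxC U : CO_join U (CO_compl U) = CO_top.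
Proof. by apply: COset_inj; exact: setUv. Qed.

Fact CO_meetxC U : CO_meet U (CO_compl U) = CO_bot.
Proof. by apply: COset_inj; exact: setICr. Qed.

HB.instance Definition _ := Order.TBDistrLattice_hasComplement.Build
  CO_display (CO T) CO_joinxC CO_meetxC.

End CO.

Definition CK (T : topologicalType) : set (CO T) :=
  [set U | compact (COset U)].

Lemma CK_ideal (T : topologicalType) : ideal_of setT (@CK T).
Proof.
split=> [//|||].
- exact: compact0.
- by move=> U V cU cV; exact: compactU.
- move=> U V _ cV /asboolP UV.
  by apply: subclosed_compact UV => //; case: (COsetP U).
Qed.

Definition Theta (X Y : topologicalType) (f : X -> Y) (cf : continuous f)
  (G : CO Y) : CO X := mkCO (preimage_clopen (COsetP G) cf).

(* Main.v *)
Require Import Defs.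
From mathcomp Require Import all_boot all_order.
From mathcomp Require Import all_classical topology.
Import Order.Theory.
Local Open Scope classical_set_scope.

(** The equivalence holds because the points of [Y] can be read off from the
    pair (CO(Y), CK(Y)): the point [y] is the bounded ultrafilter
    [clopen_nbhs_of y] of its clopen neighbourhoods, and also the proper prime
    ideal [point_ideal y] of the compact clopen sets that miss it.

    All the topology goes through compactness in the form of
    [compact_directed_cover]: a compact set covered by a family of clopen sets
    that contains the empty set and is closed under unions lies inside a single
    member of the family.  On the other side, the join of the ideals
    [ideal_below I (phi b)], [b \in K], is taken over a directed family, hence
    is a union ([idl_join_directed]), so the hypothesis in (c) and (d) says
    that every compact clopen set of [X] lies in the preimage of a single
    member of [K].

    - (a) implies (b): a surjection makes [phi] injective, because [b] is the
      image under [f] of its preimage.  The members of a bounded ultrafilter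
      share a point [y] ([bounded_filter_point]); any compact clopen
      neighbourhood of a preimage of [y] witnesses (b).
    - (b) implies (d): if [c \in J] is not in the ideal [K], then by
      compactness some [y \in c] lies outside every member of [K].  The set [a]
      that (b) gives for the ultrafilter of [y] is contained in the preimage of
      some [b \in K], whereas the complement of [b] is a neighbourhood of [y]
      whose preimage meets [a].
    - (d) implies (c), since prime ideals are ideals.
    - (c) implies (a): if [y] is outside the range of [f], then for every
      compact clopen [a] of [X] the compact set [f @` a] is covered by the
      members of [point_ideal y], hence contained in one of them.  So the join
      is all of [I], while [point_ideal y] is not all of [J]. *)

(** * Joins of directed families of ideals *)

(** The ideals [ideal_below I (phi b)] form a directed family when [K] is
    closed under joins and [phi] is monotone, and a directed union of ideals is already an ideal. *)
Lemma idl_join_directed {d1 d2 : Order.disp_t} {A : ctbDistrLatticeType d1}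
    {B : ctbDistrLatticeType d2} (I : set A) (K : set B) (phi : B -> A) :
  ideal_of setT I -> {homo phi : b c / (b <= c)%O} ->
  K \bot%O -> (forall b c, K b -> K c -> K (b `|` c)%O) ->
  idl_join I K (fun b => ideal_below I (phi b)) =
  [set a | I a /\ exists2 b, K b & (a <= phi b)%O].
Proof.
move=> [_ I0 IU ID] phi_le K0 KU; apply/seteqP; split=> a.
- apply: smallest_sub => [|{}a [b Kb [Ia ab]]]; last by split=> //; exists b.
  split.
  + by move=> {}a [].
  + by split=> //; exists \bot%O => //; exact: le0x.
  + move=> {}a a' [Ia [b Kb ab]] [Ia' [c Kc ac]]; split; first exact: IU.
    exists (b `|` c)%O; first exact: KU.
    rewrite leUx; apply/andP; split.
      by apply: (le_trans ab); apply: phi_le; exact: leUl.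
    by apply: (le_trans ac); apply: phi_le; exact: leUr.
  + move=> {}a a' Ia [_ [b Kb ab]] aa'; split=> //.
    by exists b => //; exact: le_trans aa' ab.
- by move=> [Ia [b Kb ab]]; apply: sub_gen_smallest; exists b.
Qed.

(** * Compactness and clopen sets *)

(** If no member [b] of [K] contained [A], the sets [A `\` b] would generate a
    proper filter; a cluster point of it in [A] would lie in some [b \in K],
    a neighbourhood disjoint from [A `\` b]. *)
Lemma compact_directed_cover {T : topologicalType} (A : set T)
    (K : set (CO T)) :
  compact A -> K \bot%O -> (forall b c, K b -> K c -> K (b `|` c)%O) ->
  A `<=` \bigcup_(b in K) COset b -> exists2 b, K b & A `<=` COset b.
Proof.
move=> cA K0 KU AK; apply: contrapT => nK.
pose F := filter_from K (fun b => A `\` COset b).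
have FF : ProperFilter F.
  apply: filter_from_proper => [|b Kb].
    apply: filter_from_filter; first by exists \bot%O.
    move=> b c Kb Kc; exists (b `|` c)%O; first exact: KU.
    by move=> x [Ax /not_orP[nbx ncx]]; split.
  apply: contrapT => Ab0; apply: nK; exists b => // x Ax.
  by apply: contrapT => nbx; apply: Ab0; exists x.
have FA : F A by exists \bot%O => // x [].
have [x [Ax clx]] := cA F FF FA; have [b Kb bx] := AK x Ax.
have Fb : F (A `\` COset b) by exists b.
have nx : nbhs x (COset b) by apply: open_nbhs_nbhs; split=> //; case: (COsetP b).
by have [z [[_ nbz] /nbz]] := clx _ _ Fb nx.
Qed.

(** The complements of the members of [v] are closed under union, so if they
    covered the compact member [c], a single one would contain it, and [v]
    would have two disjoint members. *)
Lemma bounded_filter_point {T : topologicalType} (v : set (CO T)) :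
  lat_proper_filter v -> v `&` @CK T !=set0 ->
  exists x, forall b, v b -> COset b x.
Proof.
move=> [vT vI vU v0] [c [vc cc]].
pose K := [set b | v (~` b)%O].
have K0 : K \bot%O by rewrite /K /= compl0.
have KU b b' : K b -> K b' -> K (b `|` b')%O.
  by rewrite /K /= complU; exact: vI.
apply: contrapT => nx; suff [b Kb cb] : exists2 b, K b & COset c `<=` COset b.
  apply: v0; apply: (vU _ _ (vI _ _ vc Kb)).
  by apply/asboolP => x [/cb bx nbx]; exact: nbx bx.
apply: compact_directed_cover => // x _; apply: contrapT => ncov; apply: nx.
exists x => b vb; apply: contrapT => nbx; apply: ncov.
by exists (~` b)%O => //; rewrite /K /= complK.
Qed.

Lemma compact_clopen_nbhs {T : topologicalType} (x : T) (U : set T) :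
  clopen_base T -> locally_compact [set: T] -> nbhs x U ->
  exists b : CO T, [/\ CK b, COset b x & COset b `<=` U].
Proof.
move=> [_ zT] lT nU; have [] := lT x I; rewrite withinET => C nC [cC _].
have [V [cV Vx] VUC] := zT x _ (filterI nU nC).
exists (mkCO cV); split=> // [|y /VUC[]//].
by apply: subclosed_compact cC _; [case: cV|move=> y /VUC[]].
Qed.

(** * Points as ultrafilters and as prime ideals *)

Definition clopen_nbhs_of {T : topologicalType} (x : T) : set (CO T) :=
  [set b | COset b x].

Definition point_ideal {T : topologicalType} (x : T) : set (CO T) :=
  [set b | CK b /\ ~ COset b x].

(** Maximality: a filter that contains all the clopen neighbourhoods of [x] and
    also a clopen set missing [x] contains two complementary sets. *)
Lemma clopen_nbhs_of_bounded_ultrafilter {T : topologicalType} (x : T)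
    (c : CO T) :
  CK c -> COset c x -> bounded_ultrafilter (@CK T) (clopen_nbhs_of x).
Proof.
move=> cc cx; split; last by exists c.
split; first by split=> //= b b' bx /asboolP; apply.
move=> w [_ wI wU w0] vw; apply/seteqP; split=> // b wb.
apply: contrapT => nbx; apply: w0.
rewrite -(meetxC b); apply: wI => //.
exact: vw.
Qed.

Lemma point_ideal_prime {T : topologicalType} (x : T) :
  prime_ideal_of (@CK T) (point_ideal x).
Proof.
have [_ C0 CU _] := CK_ideal T.
split; first split.
- by move=> b [].
- by split=> // - [].
- by move=> b c [Cb nbx] [Cc ncx]; split; [exact: CU|case].
- by move=> b c Cb [_ ncx] /asboolP bc; split=> // /bc.
- move=> b c Cb Cc [_ nbcx].
  by have [bx|nbx] := pselect (COset b x); [right|left]; split=> // cx; apply: nbcx.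
Qed.

(** * The transfer along a continuous map *)

Section Map.
Context {X Y : topologicalType} {f : X -> Y} (cf : continuous f).
Local Notation phi := (Theta cf).

Lemma Theta_homo : {homo phi : b c / (b <= c)%O}.
Proof. by move=> b c /asboolP bc; apply/asboolP => x; exact: bc. Qed.

Lemma idl_join_Theta (K : set (CO Y)) : ideal_of (@CK Y) K ->
  idl_join (@CK X) K (fun b => ideal_below (@CK X) (phi b)) =
  [set a | CK a /\ exists2 b, K b & COset a `<=` f @^-1` COset b].
Proof.
move=> [_ K0 KU _]; rewrite idl_join_directed //; last exact: Theta_homo.
- by apply/seteqP; split=> a [Ca [b Kb /asboolP ab]]; split=> //; exists b.
- exact: CK_ideal.
Qed.

Lemma Theta_inj : set_surj [set: X] [set: Y] f -> injective phi.
Proof.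
move=> sf b c /(congr1 COset) bc; apply: COset_inj.
apply/seteqP; split=> y; have [x _ <-] := sf y I.
  by rewrite -[COset b (f x)]/(COset (phi b) x) bc.
by rewrite -[COset c (f x)]/(COset (phi c) x) -bc.
Qed.

Lemma surj_bounded_ultrafilter (v : set (CO Y)) :
  clopen_base X -> locally_compact [set: X] ->
  set_surj [set: X] [set: Y] f -> bounded_ultrafilter (@CK Y) v ->
  exists2 a, CK a & forall b, v b -> (a `&` phi b <> \bot)%O.
Proof.
move=> zX lX sf [[vF _] vJ]; have [y vy] := bounded_filter_point v vF vJ.
have [x _ fx] := sf y I; have [a [Ca ax _]] := compact_clopen_nbhs x _ zX lX filterT.
exists a => // b vb /(congr1 COset) ab0.
suff : COset (\bot%O : CO X) x by [].
have bfx : COset b (f x) by rewrite fx; exact: vy.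
by rewrite -ab0; split.
Qed.

Lemma ideal_full_of_bounded_ultrafilters :
  (forall v : set (CO Y), bounded_ultrafilter (@CK Y) v ->
     exists2 a, CK a & forall b, v b -> (a `&` phi b <> \bot)%O) ->
  forall K : set (CO Y), ideal_of (@CK Y) K ->
    idl_join (@CK X) K (fun b => ideal_below (@CK X) (phi b)) = @CK X ->
    K = @CK Y.
Proof.
move=> Hv K KI; rewrite idl_join_Theta // => KX.
have [KJ K0 KU KD] := KI; apply/seteqP; split=> // c Cc.
apply: contrapT => nKc.
have [y [cy ny]] : exists y, COset c y /\ forall b, K b -> ~ COset b y.
  apply: contrapT => ny; apply: nKc.
  have [] := compact_directed_cover (COset c) K Cc K0 KU.
    move=> y cy; apply: contrapT => ncov; apply: ny; exists y; split=> // b Kb yb.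
    by apply: ncov; exists b.
  by move=> b Kb cb; apply: (KD _ b) => //; apply/asboolP.
have [a Ca av] := Hv _ (clopen_nbhs_of_bounded_ultrafilter y c Cc cy).
have [_ [b Kb ab]] : [set a | CK a /\ exists2 b, K b &
    COset a `<=` f @^-1` COset b] a by rewrite KX.
apply: (av (~` b)%O); first exact: ny.
apply: COset_inj; apply/seteqP; split=> // x [/ab bfx nbfx].
exact: nbfx bfx.
Qed.

Lemma surj_of_prime_ideals :
  clopen_base Y -> locally_compact [set: Y] -> hausdorff_space Y ->
  (forall K : set (CO Y), prime_ideal_of (@CK Y) K ->
     idl_join (@CK X) K (fun b => ideal_below (@CK X) (phi b)) = @CK X ->
     K = @CK Y) ->
  set_surj [set: X] [set: Y] f.
Proof.
move=> zY lY hY HK y _; apply: contrapT => nfy.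
have pK := point_ideal_prime y; have [KI _] := pK; have [_ K0 KU _] := KI.
have [c [Cc cy _]] := compact_clopen_nbhs y _ zY lY filterT.
suff /HK KJ : idl_join (@CK X) (point_ideal y)
    (fun b => ideal_below (@CK X) (phi b)) = @CK X.
  by have [] : point_ideal y c by rewrite KJ.
rewrite idl_join_Theta //; apply/seteqP; split=> [a []//|a Ca]; split=> //.
have Cfa : compact (f @` COset a).
  by apply: continuous_compact => //; exact: continuous_subspaceT.
have [|b Kb fab] := compact_directed_cover _ _ Cfa K0 KU; last first.
  by exists b => // x ax; apply: fab; exists x.
move=> _ [x ax <-].
have fxy : f x != y by apply/eqP => fxy; apply: nfy; exists x.
have [U [oU /set_mem Ufx /set_mem nUy]] := hausdorff_accessible hY fxy.
have [b [Cb bfx bU]] := compact_clopen_nbhs (f x) U zY lY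
  (open_nbhs_nbhs (conj oU Ufx)).
by exists b => //; split=> // /bU.
Qed.

End Map.

Theorem theorem3p8 (X Y : topologicalType)
    (zX : clopen_base X) (lX : locally_compact [set: X])
    (hX : hausdorff_space X)
    (zY : clopen_base Y) (lY : locally_compact [set: Y])
    (hY : hausdorff_space Y)
    (f : X -> Y) (cf : continuous f) :
  let I := @CK X in
  let J := @CK Y in
  let phi := Theta cf in
  [<-> (* (a) *) set_surj [set: X] [set: Y] f;
       (* (b) *) injective phi /\
         forall v : set (CO Y), bounded_ultrafilter J v ->
           exists2 a, I a &
             forall b, v b -> (a `&` phi b <> \bot)%O;
       (* (c) *) injective phi /\
         forall J1 : set (CO Y), prime_ideal_of J J1 ->
           idl_join I J1 (fun b => ideal_below I (phi b)) = I -> J1 = J;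
       (* (d) *) injective phi /\
         forall J1 : set (CO Y), ideal_of J J1 ->
           idl_join I J1 (fun b => ideal_below I (phi b)) = I -> J1 = J].
Proof.
move=> I J phi.
have ab : set_surj [set: X] [set: Y] f -> injective phi /\
    forall v : set (CO Y), bounded_ultrafilter J v ->
      exists2 a, I a & forall b, v b -> (a `&` phi b <> \bot)%O.
  move=> sf; split; first exact: Theta_inj.
  by move=> v; exact: surj_bounded_ultrafilter.
tfae => //.
- move=> [iphi Hv]; split=> // K [KI _].
  exact: ideal_full_of_bounded_ultrafilters.
- (* (d) is recovered from (c) through (a) and (b), which avoids extending
     an ideal to a prime one *)
  move=> [iphi HK]; split=> //; apply: ideal_full_of_bounded_ultrafilters.
  by have [] := ab (surj_of_prime_ideals cf zY lY hY HK).
- move=> [_ HK]; apply: (surj_of_prime_ideals cf zY lY hY) => K [KI _].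
  exact: HK.
Qed.
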